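(* For each prime number $p \geq 3$, there exists a two-point homogeneous quandle $(X,s)$ with cardinality $\# X = p$.
   Context: A quandle $(X,s)$ is a set $X$ with a map $s_x : X \to X$ for each $x \in X$ such that: (S1) $s_x(x) = x$ for all $x\in X$; (S2) $s_x$ is bijective for all $x\in X$; (S3) $s_x \circ s_y = s_{s_x(y)} \circ s_x$ for all $x,y \in X$. The inner automorphism group $\mathrm{Inn}(X,s)$ is the group of bijections of $X$ generated by $\{ s_x \mid x \in X\}$. A quandle $X$ is two-point homogeneous if for all $(x_1,x_2),(y_1,y_2)\in X\times X$ with $x_1\neq x_2$ and $y_1\neq y_2$ there exists $f \in \mathrm{Inn}(X,s)$ with $f(x_1)=y_1$ and $f(x_2)=y_2$. *)

(* Defs.v *)
From mathcomp Require Import all_boot all_fingroup.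

Set Implicit Arguments.
Unset Strict Implicit.
Unset Printing Implicit Defensive.

Local Open Scope group_scope.

(* [qs Q x y] is s_x(y): the first argument is the index of the symmetry. *)
Record quandle (X : Type) := Quandle {
  qs : X -> X -> X;
  qs_fix : forall x, qs x x = x;
  qs_bij : forall x, bijective (qs x);
  qs_conj : forall x y, qs x \o qs y =1 qs (qs x y) \o qs x
}.

Section Inn.
Variables (X : finType) (Q : quandle X).

Definition qperm (x : X) : {perm X} := perm (bij_inj (qs_bij Q x)).

(* The product of {perm X} is composition in diagrammatic order, opposite to
   \o; the set generated by the s_x is the same for either order. *)
Definition Inn : {group {perm X}} := <<[set qperm x | x : X]>>%G.

Definition two_point_homogeneous : Prop :=
  forall x1 x2 y1 y2 : X, x1 <> x2 -> y1 <> y2 ->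
  exists f : {perm X}, [/\ f \in Inn, f x1 = y1 & f x2 = y2].

End Inn.

(* Main.v *)
(** Over a finite field take the affine quandle [s_x(y) = a y + (1 - a) x], with
    [a] a generator of the multiplicative group. Its inner group contains the
    multiplications [s_0^k : y |-> a^k y], that is, by every nonzero scalar.
    As [a <> 1], it also contains every translation, in the form [s_0^-1]
    followed by [s_x]. Hence it contains the whole affine group, which is
    2-transitive. *)

Require Import Defs.
From mathcomp Require Import all_boot all_fingroup.
From mathcomp Require Import all_algebra cyclic ring.

Set Implicit Arguments.
Unset Strict Implicit.
Unset Printing Implicit Defensive.

Import GRing.Theory.

Section AffineQuandle.
Local Open Scope ring_scope.
Variables (F : finFieldType) (a : {unit F}).

Definition affine_op (x y : F) : F := val a * y + (1 - val a) * x.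

Lemma val_unit_neq0 (u : {unit F}) : val u != 0.
Proof. by rewrite -unitfE (valP u). Qed.

Lemma affine_op_fix x : affine_op x x = x.
Proof. by rewrite /affine_op; ring. Qed.

Lemma affine_op_bij x : bijective (affine_op x).
Proof.
by exists (fun y => (val a)^-1 * (y - (1 - val a) * x)) => y;
  rewrite /affine_op; field; exact: val_unit_neq0.
Qed.

Lemma affine_op_conj x y :
  affine_op x \o affine_op y =1 affine_op (affine_op x y) \o affine_op x.
Proof. by move=> z; rewrite /= /affine_op; ring. Qed.

Definition affine_quandle : quandle F :=
  Quandle affine_op_fix affine_op_bij affine_op_conj.

Let s x : {perm F} := qperm affine_quandle x.

Lemma affine_qpermE x y : s x y = val a * y + (1 - val a) * x.
Proof. by rewrite permE. Qed.

Lemma affine_qperm_Inn x : s x \in Inn affine_quandle.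
Proof. by rewrite mem_gen // imset_f. Qed.

Lemma affine_qperm0XE k y : (s 0 ^+ k)%g y = val (a ^+ k)%g * y.
Proof.
rewrite FinRing.val_unitX; elim: k => [|k IHk]; first by rewrite perm1 mul1r.
by rewrite expgSr permM IHk affine_qpermE mulr0 addr0 exprS mulrA.
Qed.

(** [s 0] and [s x] share the linear part [val a], which cancels in the quotient, leaving only the
    difference of their constant terms. *)
Lemma affine_translationE x y :
  ((s 0)^-1 * s x)%g y = y + (1 - val a) * x.
Proof.
(* Writing the right-hand [y] as [s 0 z] avoids computing the inverse permutation. *)
rewrite permM -{2}[y](permKV (s 0)); set z := ((s 0)^-1)%g y.
by rewrite !affine_qpermE mulr0 addr0.
Qed.

Lemma affine_two_point_homogeneous :
  val a != 1 -> [set: {unit F}] = <[a]>%g ->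
  two_point_homogeneous affine_quandle.
Proof.
move=> a_neq1 gen_a x1 x2 y1 y2 /eqP neq_x /eqP neq_y.
have dx : x2 - x1 != 0 by rewrite subr_eq0 eq_sym.
have dy : y2 - y1 != 0 by rewrite subr_eq0 eq_sym.
have da : 1 - val a != 0 by rewrite subr_eq0 eq_sym.
(* The slope of the affine map sending [x1] to [y1] and [x2] to [y2]; being nonzero, it is a power
   of the generator. *)
have Ub : (y2 - y1) / (x2 - x1) \is a GRing.unit.
  by rewrite unitfE mulf_neq0 ?invr_eq0.
have /cycleP[k def_b] : FinRing.unit F Ub \in <[a]>%g by rewrite -gen_a inE.
pose b := (y2 - y1) / (x2 - x1).
have bE : val (a ^+ k)%g = b by rewrite -def_b.
(* Chosen so that the translation given by [s c] adds the intercept [y1 - b * x1]. *)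
pose c := (y1 - b * x1) / (1 - val a).
(* In diagrammatic order: scale by [b] first, then translate. *)
exists (s 0 ^+ k * ((s 0)^-1 * s c))%g; split.
- by rewrite groupM ?groupX ?groupM ?groupV ?affine_qperm_Inn.
- by rewrite permM affine_translationE affine_qperm0XE bE /c; field.
- by rewrite permM affine_translationE affine_qperm0XE bE /c /b; field;
    rewrite da dx.
Qed.

End AffineQuandle.

(** The element 1 generates the trivial group, whereas the unit group has [#|F| - 1 >= 2]
    elements. *)
Lemma generator_unit_neq1 (F : finFieldType) (a : {unit F}) :
  2 < #|F| -> [set: {unit F}] = <[a]>%g -> val a != 1%R.
Proof.
move=> F_gt2 gen_a; apply/eqP => a1.
have := card_finField_unit F; rewrite gen_a.
have -> : a = 1%g by apply: val_inj.
by rewrite cycle1 cards1; case: #|F| F_gt2 => [|[|[|]]].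
Qed.

Theorem corollary4p12 (p : nat) (p_prime : prime p) (p_ge3 : 3 <= p) :
  exists (X : finType) (Q : quandle X), two_point_homogeneous Q /\ #|X| = p.
Proof.
have /cyclicP[a gen_a] := field_unit_group_cyclic [set: {unit 'F_p}]%G.
exists 'F_p, (affine_quandle a); split; last exact: card_Fp.
apply: affine_two_point_homogeneous (gen_a).
by apply: generator_unit_neq1 gen_a; rewrite card_Fp.
Qed.
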